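(* Let $\Phi$ be a local semiflow on a complete metric space $X$ and let $(N,E)$ be a transversal Ważewski pair for $\Phi$ with $E\subset N$. Let $\{M_1,\dots,M_n\}$ be a Morse decomposition of the maximal invariant set in $\overline{N\setminus E}$. Suppose that $N$ is an ANE. Then $$\mathrm{cat}_{N,E}(N)\leqslant\sum_{i=1}^n\mathrm{cat}_N(M_i).$$
   Context: Local semiflow: a continuous map $\Phi:\mathcal D(\Phi)\to X$, with $\mathcal D(\Phi)$ open in $\mathbb R^+\times X$ ($\mathbb R^+=[0,\infty)$), such that for each $x\in X$ there is $0<T_x\leqslant\infty$ with $(t,x)\in\mathcal D(\Phi)\iff 0\leqslant t<T_x$; $\Phi(0,x)=x$; and $\Phi(t+s,x)=\Phi(t,\Phi(s,x))$ whenever $(t+s,x)\in\mathcal D(\Phi)$, $t,s\geqslant 0$. Write $\Phi(t)x=\Phi(t,x)$. A set $K$ is invariant if $\Phi(t)K=K$ for all $t\geqslant0$ (with $T_x=\infty$ for $x\in K$). For $N\subset X$ put $t_N(x)=\inf\{t\geqslant0: t\geqslant T_x\text{ or }\Phi(t)x\notin N\}$ (with $\inf\emptyset=\infty$). A set $E$ is $N$-positively invariant if for all $x\in N\cap E$, $t\geqslant0$, $\Phi([0,t])x\subset N$ implies $\Phi([0,t])x\subset E$. $E$ is an exit set of $N$ if (1) $E$ is $N$-positively invariant and (2) for every $x\in N$ with $t_N(x)<T_x$ there is $t\leqslant t_N(x)$ with $\Phi(t)x\in E$. A set $A$ is admissible if for all sequences $x_n\in A$, $t_n\to+\infty$ with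 $\Phi([0,t_n])x_n\subset A$, the sequence $\Phi(t_n)x_n$ has a convergent subsequence; $A$ is strongly admissible if moreover $T_x=\infty$ whenever $\Phi(t)x\in A$ for all $t\in[0,T_x)$. A pair $(N,E)$ of closed subsets of $X$ is a Ważewski pair if $E$ is an exit set of $N$ and $\overline{N\setminus E}$ is strongly admissible (then the maximal invariant set in $\overline{N\setminus E}$ is compact). With $H=\overline{N\setminus E}$, the pair is transversal if for every $x\in H\cap E$ and $t>0$ there is $s\in(0,t)$ with $\Phi(s)x\notin H\cap E$. Morse decomposition: let $K$ be a compact invariant set. A set $M$ attracts a set $B$ if $T_x=\infty$ for all $x\in B$ and for each neighborhood $U$ of $M$ there is $T>0$ with $\Phi(t)B\subset U$ for all $t>T$. An attractor in $K$ is a nonempty compact invariant set $A\subset K$ which attracts (for the restricted semiflow $\Phi|_K$ on $K$) some neighborhood $U$ of $A$ in $K$ and is the maximal compact invariant set in $U$; $\Omega_K(A)$ is the set of $x\in K$ attracted by $A$ under $\Phi|_K$. The empty set is also allowed as $A_0$, with $\Omega_K(\emptyset)=\emptyset$. An ordered collection $\{M_1,\dots,M_n\}$ is a Morse decomposition of $K$ if there is a sequence $\emptyset=A_0\subsetneq A_1\subsetneq\cdots\subsetneq A_n=K$ of attractors in $K$ with $M_k=A_k\setminus\Omega_K(A_{k-1})$, $1\leqslant k\leqslant n$. Relative category: let $Z$ be a topological space, $I=[0,1]$. A closed set $A\subset Z$ is contractible in $Z$ if there is a continuous $h:I\times A\to Z$ with $h(0,u)=u$ and $h(1,u)=h(1,v)$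 for all $u,v\in A$. For closed $A,B,Y\subset Z$, $A\prec_Y B$ in $Z$ means $Y\subset A\cap B$ and there is a continuous $h:I\times A\to Z$ with $h(0,x)=x$, $h(1,x)\in B$ for all $x\in A$, and $h(s,Y)\subset Y$ for all $s\in I$. For closed $Y\subset A\subset Z$, $\mathrm{cat}_{Z,Y}(A)$ is the least $m\in\{0,1,2,\dots\}\cup\{\infty\}$ such that there are closed subsets $A_0,\dots,A_m$ of $Z$ with $A=\bigcup_{j=0}^mA_j$, $A_1,\dots,A_m$ contractible in $Z$, and $A_0\prec_YY$ in $Z$ ($\infty$ if no finite $m$ works). Put $\mathrm{cat}_Z(A)=\mathrm{cat}_{Z,\emptyset}(A)$. ANE: a metric space $Z$ is an absolute neighborhood extensor (ANE) if for every metric space $S$, every closed $F\subset S$ and every continuous $f:F\to Z$, there is a continuous extension of $f$ to a neighborhood of $F$ in $S$. Subsets of $X$ carry the induced metric. *)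

(* Defs.v *)
From HB Require Import structures.
From mathcomp Require Import all_boot all_order all_algebra.
From mathcomp Require Import all_classical all_reals all_analysis.

Set Implicit Arguments.
Unset Strict Implicit.
Unset Printing Implicit Defensive.

Import Order.TTheory GRing.Theory Num.Theory.
Import numFieldNormedType.Exports.

Local Open Scope classical_set_scope.
Local Open Scope ring_scope.

(** A subset [N : set X] is used as a space in its own right through the
    library's coercion of [N] to the type [set_type N] of its points, which
    already carries the induced topology and the induced balls. *)
Section induced_metric.
Context {R : realType} {X : metricType R} (N : set X).

Let dist (x y : N) : R := mdist (set_val x) (set_val y).

Let dist_ge0 x y : 0 <= dist x y. Proof. exact: mdist_ge0. Qed.

Let dist_positivity x y : dist x y = 0 -> x = y.
Proof. by move/mdist_positivity => /val_inj. Qed.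

Let ballEdist (x : N) d : ball x d = [set y | dist x y < d].
Proof.
change (set_val @^-1` ball (set_val x) d = [set y | dist x y < d]).
by rewrite ballEmdist.
Qed.

HB.instance Definition _ :=
  @PseudoMetric_isMetric.Build R N dist dist_ge0 dist_positivity ballEdist.

End induced_metric.

(** The library's [completeType] is pointed; this is its axiom without the
    requirement that the space be nonempty. *)
Definition complete_space (X : uniformType) :=
  forall F : set_system X, ProperFilter F -> cauchy F -> exists l : X, F --> l.

(** [f] is only relevant on [F] and [g] on the neighborhood [U] of [F]; their
    values elsewhere are junk. *)
Definition ANE (R : realType) (Z : metricType R) :=
  forall (S : metricType R) (F : set S) (f : S -> Z),
    closed F -> {within F, continuous f} ->
    exists (U : set S) (g : S -> Z),
      [/\ set_nbhs F U, {within U, continuous g} & {in F, g =1 f}].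

Section relative_category_def.
Variables (R : realType) (Z : topologicalType).
Implicit Types A B Y : set Z.

Definition contractible_in A :=
  exists h : R * Z -> Z,
    [/\ {within `[0, 1]%classic `*` A, continuous h},
        forall u, A u -> h (0, u) = u &
        forall u v, A u -> A v -> h (1, u) = h (1, v)].

Definition deforms_rel Y A B :=
  Y `<=` A `&` B /\
  exists h : R * Z -> Z,
    [/\ {within `[0, 1]%classic `*` A, continuous h},
        forall x, A x -> h (0, x) = x,
        forall x, A x -> B (h (1, x)) &
        forall s x, `[0, 1]%classic s -> Y x -> Y (h (s, x))].

Definition cat_cover Y A (m : nat) :=
  exists C : nat -> set Z,
    [/\ forall j, (j <= m)%N -> closed (C j),
        A = \bigcup_(j < m.+1) C j,
        forall j, (0 < j <= m)%N -> contractible_in (C j) &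
        deforms_rel Y (C 0) Y].

(** The infimum of a set of natural numbers is its least element, or [+oo] if
    the set is empty. *)
Definition rel_category Y A : \bar R :=
  ereal_inf [set m%:R%:E | m in cat_cover Y A].

Definition category A : \bar R := rel_category set0 A.

End relative_category_def.

Definition sf_dom (R : realType) (X : topologicalType) (T : X -> \bar R) :
  set (R * X) := [set p | 0 <= p.1 /\ (p.1%:E < T p.2)%E].

(** [sf_flow] is total; only its values at the points of [sf_dom] matter.  The
    first conjunct of [sf_flowD] says that the right-hand side of the semigroup
    law is defined. *)
Record local_semiflow (R : realType) (X : topologicalType) := LocalSemiflow {
  sf_flow :> R -> X -> X;
  sf_time : X -> \bar R;
  sf_time_gt0 : forall x, (0 < sf_time x)%E;
  sf_dom_open : exists2 O : set (R * X),
    open O & sf_dom sf_time = O `&` [set p | 0 <= p.1];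
  sf_continuous :
    {within sf_dom sf_time, continuous (fun p : R * X => sf_flow p.1 p.2)};
  sf_flow0 : forall x, sf_flow 0 x = x;
  sf_flowD : forall t s x, 0 <= t -> 0 <= s -> ((t + s)%:E < sf_time x)%E ->
    (t%:E < sf_time (sf_flow s x))%E /\
    sf_flow (t + s) x = sf_flow t (sf_flow s x)
}.

Section semiflow.
Variables (R : realType) (X : topologicalType) (Phi : local_semiflow R X).
Implicit Types (N E H K M A B U : set X) (t : R) (x : X).
Local Notation T := (sf_time Phi).

Definition invariant_set K :=
  (forall x, K x -> T x = +oo%E) /\ forall t, 0 <= t -> Phi t @` K = K.

Definition max_invariant_set H : set X :=
  \bigcup_(K in [set K | invariant_set K /\ K `<=` H]) K.

Definition exit_time N x : \bar R :=
  ereal_inf [set t%:E | t in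
    [set t | 0 <= t /\ ((T x <= t%:E)%E \/ ~ N (Phi t x))]].

(** [Phi([0, t]) x] is defined and contained in [N]. *)
Definition stays_in N x t :=
  [/\ 0 <= t, (t%:E < T x)%E & forall s, 0 <= s <= t -> N (Phi s x)].

Definition positively_invariant_in N E :=
  forall x t, (N `&` E) x -> stays_in N x t -> stays_in E x t.

Definition exit_set N E :=
  positively_invariant_in N E /\
  forall x, N x -> (exit_time N x < T x)%E ->
    exists t, [/\ 0 <= t, (t%:E <= exit_time N x)%E & E (Phi t x)].

Definition admissible A :=
  forall (x_ : nat -> X) (t_ : nat -> R),
    t_ @ \oo --> +oo -> (forall n, stays_in A (x_ n) (t_ n)) ->
    exists (k : nat -> nat) (l : X),
      increasing_seq k /\ (fun n => Phi (t_ (k n)) (x_ (k n))) @ \oo --> l.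

Definition strongly_admissible A :=
  admissible A /\
  forall x, (forall t, 0 <= t -> (t%:E < T x)%E -> A (Phi t x)) ->
    T x = +oo%E.

Definition wazewski_pair N E :=
  [/\ closed N, closed E, exit_set N E &
      strongly_admissible (closure (N `\` E))].

Definition transversal_pair N E :=
  let HE := closure (N `\` E) `&` E in
  forall x t, HE x -> 0 < t ->
    exists s, [/\ 0 < s < t, (s%:E < T x)%E & ~ HE (Phi s x)].

Definition nbhd_in K M U :=
  U `<=` K /\ forall x, M x -> within K (nbhs x) U.

(** Attraction for the semiflow restricted to the invariant set [K]. *)
Definition attracts_in K M B :=
  (forall x, B x -> T x = +oo%E) /\
  forall U, nbhd_in K M U ->
    exists2 t0, 0 < t0 & forall t, t0 < t -> Phi t @` B `<=` U.

Definition attractor_in K A :=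
  [/\ A !=set0, compact A, invariant_set A, A `<=` K &
      exists U, [/\ nbhd_in K A U, attracts_in K A U &
        forall B, compact B -> invariant_set B -> B `<=` U -> B `<=` A]].

(** [Omega_K(A)]; it is empty for [A = set0], since then [U = set0] is a
    neighborhood of [A] in [K]. *)
Definition attraction_basin K A : set X :=
  [set x | K x /\ attracts_in K A [set x]].

(** [M] is indexed from 0, so that [M k] lies in [A k.+1] and avoids the basin
    of [A k].  The case [n = 0] is possible only when [K] is empty. *)
Definition morse_decomposition K (n : nat) (M : 'I_n -> set X) :=
  exists A : nat -> set X,
    [/\ A 0 = set0, A n = K,
        forall k, (k < n)%N -> A k `<` A k.+1,
        forall k, (0 < k <= n)%N -> attractor_in K (A k) &
        forall k : 'I_n, M k = A k.+1 `\` attraction_basin K (A k)].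

End semiflow.

(* Main.v *)
(** Stop every orbit when it first meets [E].  Transversality makes the hitting
    time continuous on [N], so this gives a continuous semiflow [Psi] on [N] that
    fixes [E].  The stable set [S], where [E] is never met, is closed and
    asymptotically compact, hence limit sets of nets of orbits in [S] lie in the
    maximal invariant set.  It follows that for each attractor [A k] the set
    [P k] of points which are locally uniformly attracted by [A k] or reach [E]
    is open, and that from [P k.+1] the flow enters any open set containing [P k]
    and the Morse set between [A k] and [A k.+1], locally uniformly and for good.
    As [N] is an ANE, that Morse set has a neighborhood covered by equally many
    contractible closed sets.  Flowing for a continuous waiting time, a closed
    subset of [P k.+1] is covered by preimages of these sets and a closed part
    that is carried into [P k], hence lies in [P k], since [P k] is invariant
    backwards.  Descending from [P n = N], what remains lies in [P 0] and is
    deformed into [E] by the flow. *)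
Require Import Defs.
From HB Require Import structures.
From mathcomp Require Import all_boot all_order all_algebra.
From mathcomp Require Import all_classical all_reals all_analysis.
From mathcomp Require Import lra.

Set Implicit Arguments.
Unset Strict Implicit.
Unset Printing Implicit Defensive.

Import Order.TTheory GRing.Theory Num.Theory.
Import numFieldNormedType.Exports.

Local Open Scope classical_set_scope.
Local Open Scope ring_scope.

(** * The maximum metric on a product, so that [ANE] applies with [S] equal to [R * Z] *)

Section product_metric.
Context {R : realType} {U V : metricType R}.

Let dist (x y : U * V) : R := Order.max (mdist x.1 y.1) (mdist x.2 y.2).

Let dist_ge0 x y : 0 <= dist x y.
Proof. by rewrite le_max mdist_ge0. Qed.

Let dist_positivity x y : dist x y = 0 -> x = y.
Proof.
case: x y => [a b] [c d]; rewrite /dist /= => h.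
have /mdist_positivity -> : mdist a c = 0.
  by apply/eqP; rewrite eq_le mdist_ge0 andbT -h le_max lexx.
have /mdist_positivity -> // : mdist b d = 0.
by apply/eqP; rewrite eq_le mdist_ge0 andbT -h le_max lexx orbT.
Qed.

Let ballEdist (x : U * V) d : ball x d = [set y | dist x y < d].
Proof.
rewrite {1}/ball/= /prod_ball !ballEmdist/=; apply/seteqP.
by split=> y /=; rewrite /dist gt_max => /andP.
Qed.

HB.instance Definition _ :=
  @PseudoMetric_isMetric.Build R (U * V)%type dist dist_ge0 dist_positivity
    ballEdist.

End product_metric.

(** * Separation in metric spaces and continuity on a subset *)

Section topology.

Lemma metric_closed_open_shrink {R : realType} (Z : metricType R) (A W : set Z) :
  closed A -> open W -> A `<=` W ->
  exists V, [/\ open V, A `<=` V & closure V `<=` W].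
Proof.
move=> cA oW AW.
have AW' : set_nbhs A W by apply/set_nbhsP; exists W; split.
have [B /set_nbhsP[V [oV AV VB]] BW] := @pseudometric_normal R Z _ cA W AW'.
exists V; split => //.
by apply: subset_trans BW; exact: closureS.
Qed.

Lemma within_comp {U V W : topologicalType} (A : set U) (B : set V)
    (f : U -> V) (g : V -> W) :
  {within A, continuous f} -> {within B, continuous g} -> f @` A `<=` B ->
  {within A, continuous (g \o f)}.
Proof.
move=> /subspace_continuousP cf /subspace_continuousP cg fAB.
apply/subspace_continuousP => x Ax O gO.
have := cg (f x) (fAB _ (imageP f Ax)) O gO.
move=> /(cf x Ax); rewrite /nbhs/= /fmap /within /=.
apply: filterS => y h Ay; apply: (h Ay); apply: fAB; exact: imageP.
Qed.

Lemma within_continuous_pair {U V W : topologicalType} (A : set U)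
    (f : U -> V) (g : U -> W) :
  {within A, continuous f} -> {within A, continuous g} ->
  {within A, continuous (fun x => (f x, g x))}.
Proof.
move=> /subspace_continuousP cf /subspace_continuousP cg.
by apply/subspace_continuousP => x Ax; apply: cvg_pair; [exact: cf|exact: cg].
Qed.

End topology.

(** * Contractible neighborhoods in an absolute neighborhood extensor *)

Section contractible_nbhd.
Context {R : realType}.

Lemma tube_nbhs {Z : topologicalType} (a b : R) (O : set (R * Z)) (x : Z) :
  open O -> (forall s, a <= s <= b -> O (s, x)) ->
  \forall y \near x, forall s, a <= s <= b -> O (s, y).
Proof.
move=> oO Ox.
have /compact_near_coveringP/(_ _ (nbhs x) (fun y s => O (s, y)) _) :=
  @segment_compact R a b.
have cov : forall s, `[a, b]%classic s ->
    \forall s' \near s & y \near x, O (s', y).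
  move=> s /=; rewrite in_itv/= => /Ox Osx.
  have : nbhs (s, x) O by apply: open_nbhs_nbhs.
  by apply: filterS => -[].
move=> /(_ cov); apply: filterS => y abO s abs; apply: abO.
by rewrite /= in_itv.
Qed.

Lemma closed_setX {U V : topologicalType} (A : set U) (B : set V) :
  closed A -> closed B -> closed (A `*` B).
Proof.
move=> cA cB; have -> : A `*` B = fst @^-1` A `&` snd @^-1` B by [].
apply: closedI.
  by apply: preimage_closed => // x _; exact: cvg_fst.
by apply: preimage_closed => // x _; exact: cvg_snd.
Qed.

(** Prolong the contraction of [A] over all of [Z] by the identity at time 0 and by a constant at
    time 1, then extend it from this closed subset of [R * Z]. Both ends being prescribed
    everywhere, the extension contracts any set whose cylinder lies where it is continuous. *)
Lemma contractible_closed_nbhd {Z : metricType R} (Z_ANE : ANE Z)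
    (A Y : set Z) :
  closed A -> closed Y -> A `&` Y = set0 -> contractible_in R A ->
  exists V, [/\ open V, A `<=` V, closure V `&` Y = set0 &
    contractible_in R (closure V)].
Proof.
move=> cA cY AY [h [hc h0 h1]].
have [->|/set0P[a0 Aa0]] := eqVneq A set0.
  exists set0; split => //; first exact: open0.
    by rewrite closure0 set0I.
  exists snd; rewrite closure0; split => //.
  by rewrite setX0; exact: continuous_subspace0.
pose I01 : set R := `[0, 1]%classic.
pose F0 : set (R^o * Z) := I01 `*` A.
pose F1 : set (R^o * Z) := [set 0] `*` setT.
pose F2 : set (R^o * Z) := [set 1] `*` setT.
pose F : set (R^o * Z) := F0 `|` (F1 `|` F2).
(* The three formulas agree on overlaps: on [A], [h] starts at the identity and ends at the constant
   [h (1, a0)]. *)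
pose f (p : R^o * Z) := if p.1 == 0 then p.2 else
  if p.1 == 1 then h (1, a0) else h p.
have cF0 : closed F0 by apply: closed_setX => //; exact: interval_closed.
have cF1 : closed F1.
  by apply: closed_setX; [exact: closed_eq|exact: closedT].
have cF2 : closed F2.
  by apply: closed_setX; [exact: closed_eq|exact: closedT].
have cf : {within F, continuous f}.
  apply: withinU_continuous => //; first exact: closedU.
    apply: subspace_eq_continuous hc => -[s u] /set_mem[/= _ Au].
    rewrite /from_subspace /f/=.
    have [->|_] := eqVneq s 0; first exact: h0.
    by have [->|//] := eqVneq s 1; exact: h1.
  apply: withinU_continuous => //.
    apply: (@subspace_eq_continuous _ _ _ snd); last first.
      by apply: continuous_subspaceT => x; exact: cvg_snd.
    by move=> [s u] /set_mem[/= -> _]; rewrite /from_subspace /f/= eqxx.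
  apply: (@subspace_eq_continuous _ _ _ (fun=> h (1, a0))); last first.
    by apply: continuous_subspaceT => x; exact: cvg_cst.
  by move=> [s u] /set_mem[/= -> _]; rewrite /from_subspace /f/= eqxx oner_eq0.
have cF : closed F by apply: closedU => //; exact: closedU.
have [U [g [/set_nbhsP[G [oG FG GU]] gc gf]]] := Z_ANE _ F f cF cf.
(* Over [W] the whole cylinder lies in the open set [G], where [g] is continuous; by the tube lemma
   [A] is interior to [W]. *)
pose W : set Z := [set x | forall s, 0 <= s <= 1 -> G (s, x)].
have AW : A `<=` W° `&` ~` Y.
  move=> x Ax; split; last by move=> Yx; rewrite -[False]/(set0 x) -AY.
  apply: tube_nbhs => // s s01; by apply: FG; left.
have [V [oV AV VW]] := metric_closed_open_shrink cA
  (openI (@open_interior _ W) (closed_openC cY)) AW.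
exists V; split => //; first by apply/disjoints_subset => x /VW[].
have g01 : {in [set 0; 1] `*` [set: Z], g =1 f}.
  move=> [s u] /set_mem[/= [] -> _]; apply: gf; apply/mem_set; right.
    by left.
  by right.
exists g; split.
- apply: continuous_subspaceW gc => -[s u] [/= s01 /VW[/interior_subset]].
  move=> /(_ s) Gsu _; apply: GU; apply: Gsu.
  by move: s01; rewrite /= in_itv.
- move=> u _; rewrite g01 /f/= ?eqxx//.
  by apply/mem_set; split => //; left.
- move=> u v _ _; rewrite !g01 /f/= ?eqxx ?oner_eq0//.
  by apply/mem_set; split => //; right.
  by apply/mem_set; split => //; right.
Qed.

End contractible_nbhd.

(** * Continuous choice of a waiting time *)

Section continuous_time.
Context {R : realType} {Z : metricType R}.

(* [tau = 2 / delta], where [delta x] is the largest [r <= 1] such that [Q t]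
   holds on the ball of radius [r] at [x] for all [t >= 1 / r]; enlarging the
   radius by [d] costs at most [d], so [delta] is 1-Lipschitz. *)
Lemma continuous_waiting_time (Q : R -> Z -> Prop) (C : set Z) :
  (forall x, C x -> \forall y \near x & t \near +oo, Q t y) ->
  exists tau : Z -> R, {within C, continuous tau} /\
    forall x, C x -> 0 <= tau x /\ Q (tau x) x.
Proof.
move=> CQ.
pose S x := [set r : R | 0 <= r <= 1 /\
  forall y t, mdist x y < r -> 1 <= t * r -> Q t y].
pose delta x := sup (S x).
have S0 x : S x 0.
  by split; [rewrite lexx ler01|move=> y t; rewrite ltNge mdist_ge0].
have supS x : has_sup (S x).
  by split; [exists 0|exists 1 => r [/andP[]]].
have delta_ge x r : S x r -> r <= delta x.
  by move=> Sr; apply: ub_le_sup => //; case: (supS x).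
have delta_lip x y : delta x <= mdist x y + delta y.
  apply: ge_sup; first by exists 0.
  move=> r [/andP[r0 r1] rQ].
  have [rd|rd] := ltP r (mdist x y).
    by rewrite (le_trans (ltW rd))// lerDl delta_ge.
  rewrite -lerBlDl; apply: delta_ge; split.
    have := mdist_ge0 x y => d0.
    by apply/andP; split; lra.
  move=> z t yz tr; apply: rQ.
    by have := metric_triangle x y z; lra.
  have d0 := mdist_ge0 x y.
  have t0 : 0 <= t by rewrite leNgt; apply/negP => t0; nra.
  nra.
have delta_cont : continuous delta.
  move=> x; apply/cvgrPdist_lt => e e0.
  apply/nbhs_ballP; exists e => // y; rewrite ballEmdist /= => xy.
  have := delta_lip x y; have := delta_lip y x; rewrite (metric_sym y x).
  by rewrite ltr_distl => h1 h2; apply/andP; split; lra.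
have delta_gt0 x : C x -> 0 < delta x.
  move=> /CQ[[A B] /= [/nbhs_ballP[e /= e0 eA] [M [_ MB]]] AB].
  pose r := Num.min (Num.min e 1) (1 / (`|M| + 1)).
  have M1 : 0 < `|M| + 1 by rewrite ltr_wpDl.
  have r0 : 0 < r by rewrite !lt_min e0 ltr01 divr_gt0.
  apply: (lt_le_trans r0); apply: delta_ge; split.
    by rewrite (ltW r0)/= !ge_min lexx orbT.
  move=> y t xy tr; apply: (AB (y, t)); split => /=.
    by apply: eA; rewrite ballEmdist/=; apply: (lt_le_trans xy); rewrite !ge_min lexx.
  apply: MB; have rM : r <= 1 / (`|M| + 1) by rewrite ge_min lexx orbT.
  have t0 : 0 < t by rewrite ltNge; apply/negP => t0; nra.
  have : 1 <= t * (1 / (`|M| + 1)).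
    by apply: (le_trans tr); rewrite ler_pM2l.
  rewrite mulrA mulr1 ler_pdivlMr// mul1r => Mt.
  by have := ler_norm M; lra.
(* The factor 2 makes up for a supremum that may not be attained: some [r] in [S x] exceeds
   [delta x / 2], so [2 / delta x * r >= 1]. *)
exists (fun x => 2 / delta x); split.
  apply: continuous_in_subspaceT => x /set_mem Cx.
  apply: cvgM; first exact: cvg_cst.
  by apply: cvgV; [rewrite gt_eqF// delta_gt0|exact: delta_cont].
move=> x Cx; have d0 := delta_gt0 x Cx.
split; first by rewrite divr_ge0// ltW.
have d2 : 0 < delta x / 2 by rewrite divr_gt0.
have [r Sr dr] := sup_adherent d2 (supS x).
have {}dr : delta x / 2 < r by move: dr; rewrite -/(delta x); lra.
case: Sr => _; apply; first by rewrite mdistxx; lra.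
by rewrite mulrAC ler_pdivlMr//; lra.
Qed.

End continuous_time.

(** * Operations on the covers that define relative category *)

Section category_estimate.
Context {R : realType}.

Lemma closed_within_preimage {U V : topologicalType} (C : set U) (f : U -> V)
    (F : set V) :
  closed C -> {within C, continuous f} -> closed F -> closed (C `&` f @^-1` F).
Proof.
move=> cC /continuous_closedP cf /cf /closed_subspaceP[W cW WC].
by rewrite setIC -WC; exact: closedI.
Qed.

(** Run [phi] at double speed, then the contraction of [D]; the halves match at time 1/2 because [h]
    starts at the identity. *)
Lemma contractible_pullback {Z : topologicalType} (B D : set Z)
    (phi : R * Z -> Z) :
  closed B -> {within `[0, 1]%classic `*` B, continuous phi} ->
  (forall x, B x -> phi (0, x) = x) -> (forall x, B x -> D (phi (1, x))) ->
  contractible_in R D -> contractible_in R B.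
Proof.
move=> cB phic phi0 phi1 [h [hc h0 h1]].
pose f (p : R * Z) := phi (2 * p.1, p.2).
pose g (p : R * Z) := h (2 * p.1 - 1, phi (1, p.2)).
pose k (p : R * Z) := if p.1 <= 2^-1 then f p else g p.
have c2 (a b : R) : {within `[a, b]%classic `*` B,
    continuous (fun p : R * Z => 2 * p.1)}.
  apply: continuous_subspaceT => p.
  by apply: cvgM; [exact: cvg_cst|exact: cvg_fst].
have cs (a b : R) : {within `[a, b]%classic `*` B, continuous (@snd R Z)}.
  by apply: continuous_subspaceT => p; exact: cvg_snd.
exists k; split.
- have -> : `[0, 1 : R]%classic `*` B = `[0, 2^-1]%classic `*` B `|`
      `[2^-1, 1]%classic `*` B.
    apply/seteqP; split => -[s x] /=; rewrite !in_itv/=.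
      move=> [/andP[s0 s1] Bx].
      have [s2|s2] := leP s 2^-1; [left|right]; split => //=.
        by rewrite s0.
      by rewrite (ltW s2).
    by case=> -[/andP[? ?] Bx]; split => //; apply/andP; split; lra.
  apply: withinU_continuous.
  + by apply: closed_setX => //; exact: interval_closed.
  + by apply: closed_setX => //; exact: interval_closed.
  + apply: (@subspace_eq_continuous _ _ _ f).
      move=> [s x] /set_mem[/=]; rewrite in_itv/= => /andP[_ s2] _.
      by rewrite /from_subspace /k/= s2.
    apply: within_comp phic _; first by apply: within_continuous_pair.
    move=> _ [[s x] [/= + Bx] <-]; rewrite /= !in_itv/= => /andP[s0 s1].
    by split => //; apply/andP; split; lra.
  + apply: (@subspace_eq_continuous _ _ _ g).
      move=> [s x] /set_mem[/=]; rewrite in_itv/= => /andP[s2 _] Bx.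
      rewrite /from_subspace /k/=; case: ifPn => // s2'.
      have -> : s = 2^-1 by apply/eqP; rewrite eq_le s2 s2'.
      by rewrite /f /g/= divff// subrr h0//; exact: phi1.
    apply: (@within_comp _ _ _ _ (`[0, 1 : R]%classic `*` D)
      (fun p : R * Z => (2 * p.1 - 1, phi (1, p.2))) h) => //.
      apply: within_continuous_pair.
        apply: continuous_subspaceT => p.
        apply: cvgB; last exact: cvg_cst.
        by apply: cvgM; [exact: cvg_cst|exact: cvg_fst].
      apply: within_comp phic _; first apply: within_continuous_pair => //.
        by apply: continuous_subspaceT => p; exact: cvg_cst.
      by move=> _ [[s x] [/= _ Bx] <-]; split => //=; rewrite in_itv/= ler01 lexx.
    move=> _ [[s x] [/= + Bx] <-]; rewrite /= !in_itv/= => /andP[s0 s1].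
    by split; [apply/andP; split; lra|exact: phi1].
- by move=> u Bu; rewrite /k/= invr_ge0 ler0n /f/= mulr0 phi0.
- move=> u v Bu Bv; rewrite /k/=.
  have -> : (1 <= 2^-1 :> R) = false by apply/negbTE; rewrite -ltNge; lra.
  rewrite /g/=; have -> : 2 * 1 - 1 = 1 :> R by lra.
  by apply: h1; exact: phi1.
Qed.

Lemma cat_coverU {Z : topologicalType} (Y A B : set Z) (m : nat) :
  cat_cover R Y A m -> closed B -> contractible_in R B ->
  cat_cover R Y (A `|` B) m.+1.
Proof.
move=> [C [cC AC kC dC]] cB kB.
exists (fun j => if (j <= m)%N then C j else B); split => //.
- by move=> j _; case: ifPn => // jm; exact: cC.
- rewrite AC; apply/seteqP; split => x.
    move=> [[j /= jm Cx]|Bx].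
      by exists j => /=; [exact: leqW|rewrite -ltnS jm].
    by exists m.+1 => //=; rewrite ltnn.
  move=> [j /= jm]; case: ifPn => [jm' Cx|_ Bx]; last by right.
  by left; exists j.
- move=> j /andP[j0 _]; case: ifPn => // jm.
  by apply: kC; rewrite j0.
Qed.

Lemma cat_cover_bigcup {Z : topologicalType} (Y A : set Z) (B : nat -> set Z)
    (k m : nat) :
  cat_cover R Y A k -> (forall j, (j < m)%N -> closed (B j)) ->
  (forall j, (j < m)%N -> contractible_in R (B j)) ->
  cat_cover R Y (A `|` \bigcup_(j < m) B j) (k + m).
Proof.
move=> kA; elim: m => [|m IH] cB cc.
  by rewrite II0 bigcup_set0 setU0 addn0.
have -> : A `|` \bigcup_(j < m.+1) B j = A `|` \bigcup_(j < m) B j `|` B m.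
  by rewrite IISl bigcup_setU1 [B m `|` _]setUC setUA.
rewrite addnS; apply: cat_coverU; [|exact: cB|exact: cc].
by apply: IH => j jm; [apply: cB|apply: cc]; exact: ltnW.
Qed.

(** [C 0] is deformed into the empty set, hence empty; the other pieces are renumbered from 0. *)
Lemma cat_cover0P {Z : topologicalType} (M : set Z) (m : nat) :
  cat_cover R set0 M m -> exists D : nat -> set Z,
    [/\ forall j, (j < m)%N -> closed (D j),
        forall j, (j < m)%N -> contractible_in R (D j) &
        M = \bigcup_(j < m) D j].
Proof.
move=> [C [cC MC kC [_ [h [_ _ h1 _]]]]].
exists (fun j => C j.+1); split.
- by move=> j jm; exact: cC.
- by move=> j jm; exact: kC.
- rewrite MC; apply/seteqP; split => x.
    by move=> [[|j] /= jm Cx]; [have := h1 _ Cx|exists j].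
  by move=> [j /= jm Cx]; exists j.+1.
Qed.

(** * Covers obtained by flowing; [Psi] will be the stopped flow and [Y] the exit set *)

Variables (Z : metricType R) (Z_ANE : ANE Z) (Psi : R * Z -> Z) (Y : set Z).
Hypotheses (Psi_cont : continuous Psi) (Psi0 : forall x, Psi (0, x) = x).
Hypotheses (Y_closed : closed Y).
Hypotheses (Psi_Y : forall t x, 0 <= t -> Y x -> Psi (t, x) = x).

Lemma within_flow_time (tau : Z -> R) (C : set Z) :
  {within C, continuous tau} ->
  {within `[0, 1]%classic `*` C, continuous
    (fun p : R * Z => Psi (p.1 * tau p.2, p.2))}.
Proof.
move=> /subspace_continuousP tauc; apply/subspace_continuousP => -[s x] [/= _ Cx].
have tx : (fun p : R * Z => tau p.2) @
    within (`[0, 1 : R]%classic `*` C) (nbhs (s, x)) --> tau x.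
  move=> G /(tauc _ Cx) /=; rewrite !near_simpl /within/=.
  move=> h; have : nbhs (s, x) (fun p => C p.2 -> G (tau p.2)).
    exact: (@cvg_snd _ _ (nbhs s) (nbhs x) _ (fun y => C y -> G (tau y)) h).
  by apply: filterS => p /= h' [_ /h'].
set D := `[0, 1]%classic `*` C.
have ps : fst @ within D (nbhs (s, x)) --> s.
  exact: (cvg_within_filter D (@cvg_fst _ _ (nbhs s) (nbhs x) _)).
have px : snd @ within D (nbhs (s, x)) --> x.
  exact: (cvg_within_filter D (@cvg_snd _ _ (nbhs s) (nbhs x) _)).
have c2 : (fun p : R * Z => (p.1 * tau p.2, p.2)) @ within D (nbhs (s, x))
    --> (s * tau x, x).
  exact: (@cvg_pair _ _ _ _ (nbhs (s * tau x)) (nbhs x) _ _ _ _ _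
            (cvgM ps tx) px).
exact: (cvg_comp _ _ c2 (@Psi_cont (s * tau x, x))).
Qed.

(** Base of the descent: flowing for a continuous waiting time deforms [C] into [Y], so [C] itself
    serves as the piece of index 0. *)
Lemma cat_cover_deform (C : set Z) :
  closed C -> Y `<=` C ->
  (forall x, C x -> \forall y \near x & t \near +oo, Y (Psi (t, y))) ->
  cat_cover R Y C 0.
Proof.
move=> cC YC CY.
have [tau [tauc tauY]] := continuous_waiting_time CY.
exists (fun=> C); split => //.
- by apply/seteqP; split => x; [exists 0%N|move=> []].
- by case.
- split; first by move=> x Yx; split => //; exact: YC.
  exists (fun p : R * Z => Psi (p.1 * tau p.2, p.2)); split => /=.
  + exact: within_flow_time.
  + by move=> x _; rewrite mul0r.
  + by move=> x /tauY[_]; rewrite mul1r.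
  + move=> s x; rewrite in_itv/= => /andP[s0 _] Yx.
    rewrite Psi_Y// mulr_ge0//; by have [] := tauY x (YC _ Yx).
Qed.

(** Thicken the [m] contractible pieces of [M] to open sets [V j] with union [W], and flow [C] into
    [P] or [W]. Points landing in the closure of [V j] form a contractible set by
    [contractible_pullback]; points that miss [W] land in [P], so they already lie in [P] and cost
    [k] pieces. *)
Lemma cat_cover_excise (C P M : set Z) (k m : nat) :
  closed C -> Y `<=` C -> open P -> Y `<=` P ->
  (forall t x, 0 <= t -> P (Psi (t, x)) -> P x) ->
  M `&` Y = set0 -> cat_cover R set0 M m ->
  (forall x G, C x -> open G -> P `|` M `<=` G ->
    \forall y \near x & t \near +oo, G (Psi (t, y))) ->
  (forall B, closed B -> Y `<=` B -> B `<=` P -> cat_cover R Y B k) ->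
  cat_cover R Y C (k + m).
Proof.
move=> cC YC oP YP Pback MY /cat_cover0P[D [cD kD MD]] CG IH.
have /choice[V HV] : forall j, exists V : set Z, (j < m)%N ->
    [/\ open V, D j `<=` V, closure V `&` Y = set0 &
      contractible_in R (closure V)].
  move=> j; have [jm|jm] := ltnP j m; last by exists set0.
  have DY : D j `&` Y = set0.
    rewrite -subset0 => x [Dx Yx]; rewrite -MY; split => //.
    by rewrite MD; exists j.
  have [V HV] := contractible_closed_nbhd Z_ANE (cD _ jm) Y_closed DY (kD _ jm).
  by exists V.
pose W := \bigcup_(j < m) V j.
have oW : open W by apply: bigcup_open => j /HV[].
have MW : M `<=` W.
  rewrite MD => x [j jm Dx]; exists j => //.
  by have [_ + _ _] := HV j jm; exact.
(* Being fixed by the flow and disjoint from [W], the set [Y] stays in the remainder [C']. *)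
have WY x : W x -> ~ Y x.
  move=> [j jm Vx Yx]; have [_ _ VY _] := HV j jm.
  by rewrite -[False]/(set0 x) -VY; split => //; exact: subset_closure.
have CW : forall x, C x -> \forall y \near x & t \near +oo, (P `|` W) (Psi (t, y)).
  move=> x Cx; apply: CG => //; first exact: openU.
  exact: setUS.
have [tau [tauc tauW]] := continuous_waiting_time CW.
pose phi (p : R * Z) := Psi (p.1 * tau p.2, p.2).
have phic : {within `[0, 1]%classic `*` C, continuous phi}.
  exact: within_flow_time.
pose phi1 x := phi (1, x).
have phi1c : {within C, continuous phi1}.
  apply: (@within_comp _ _ _ _ (`[0, 1 : R]%classic `*` C) (fun x => (1, x)) phi) => //.
    apply: within_continuous_pair; apply: continuous_subspaceT => x //.
    exact: cvg_cst.
  by move=> _ [x Cx <-]; split => //=; rewrite in_itv/= ler01 lexx.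
pose C' := C `&` phi1 @^-1` (~` W).
pose B j := C `&` phi1 @^-1` (closure (V j)).
have -> : C = C' `|` \bigcup_(j < m) B j.
  apply/seteqP; split => x; last by case=> [[]|[j _ []]].
  move=> Cx; have [[j jm Vx]|nW] := pselect (W (phi1 x)); last by left.
  by right; exists j => //; split => //; exact: subset_closure.
have cB j : closed (B j).
  by apply: closed_within_preimage => //; exact: closed_closure.
have tau_ge0 x : C x -> 0 <= tau x by move=> /tauW[].
apply: cat_cover_bigcup => // [|j jm].
  apply: IH.
  - by apply: closed_within_preimage => //; exact: open_closedC.
  - move=> x Yx; split; first exact: YC.
    move=> /WY; apply; rewrite /phi1 /phi/= mul1r Psi_Y//.
    exact/tau_ge0/YC.
  - move=> x [Cx /= nWx]; have [t0] := tauW x Cx.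
    rewrite /phi1 /phi/= mul1r in nWx => -[Px|//].
    exact: Pback Px.
apply: (contractible_pullback _ _ _ _ (_ : contractible_in R (closure (V j)))).
- exact: cB.
- by apply: continuous_subspaceW phic => -[s x] [/= ? []].
- by move=> x _; rewrite /phi/= mul0r.
- by move=> x [].
- by have [] := HV j jm.
Qed.

(** Excising the top set [M n] leaves a closed subset of [P n], to which the induction hypothesis
    applies. *)
Lemma cat_cover_filtration (P M : nat -> set Z) (m : nat -> nat) (n : nat) :
  (forall k, (k < n)%N -> open (P k)) -> (forall k, (k < n)%N -> Y `<=` P k) ->
  (forall k t x, (k < n)%N -> 0 <= t -> P k (Psi (t, x)) -> P k x) ->
  (forall k, (k < n)%N -> M k `&` Y = set0) ->
  (forall k, (k < n)%N -> cat_cover R set0 (M k) (m k)) ->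
  (forall x, P 0%N x -> \forall y \near x & t \near +oo, Y (Psi (t, y))) ->
  (forall k x G, (k < n)%N -> P k.+1 x -> open G -> P k `|` M k `<=` G ->
    \forall y \near x & t \near +oo, G (Psi (t, y))) ->
  forall C, closed C -> Y `<=` C -> C `<=` P n ->
  cat_cover R Y C (\sum_(0 <= i < n) m i).
Proof.
elim: n => [|n IH] oP YP Pback MY catM P0 Pstep C cC YC CP.
  rewrite big_nil; apply: cat_cover_deform => // x /CP; exact: P0.
rewrite big_nat_recr//=.
apply: (@cat_cover_excise C (P n) (M n)) => //.
- exact: oP.
- exact: YP.
- by move=> t x; exact: Pback.
- exact: MY.
- exact: catM.
- by move=> x G /CP; exact: Pstep.
- move=> B cB YB BP; apply: IH => //.
  + by move=> k /ltnW kn; exact: oP.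
  + by move=> k /ltnW kn; exact: YP.
  + by move=> k t x /ltnW kn; exact: Pback.
  + by move=> k /ltnW kn; exact: MY.
  + by move=> k /ltnW kn; exact: catM.
  + by move=> k x G /ltnW kn; exact: Pstep.
Qed.

End category_estimate.

(** * Continuity of the hitting time of the exit set *)

Section hitting_time.
Variables (R : realType) (X : metricType R) (Phi : local_semiflow R X).
Local Notation T := (sf_time Phi).

(** The guard [0 <= p.1] matters at [s = 0]: the domain is open only relative to nonnegative
    times. *)
Lemma flow_near (s : R) (x : X) (G : set X) :
  0 <= s -> (s%:E < T x)%E -> open G -> G (Phi s x) ->
  \forall p \near (s, x), 0 <= p.1 -> (p.1%:E < T p.2)%E /\ G (Phi p.1 p.2).
Proof.
move=> s0 sT oG Gx.
have [D oD DE] := sf_dom_open Phi.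
have dx : sf_dom T (s, x) by [].
have Dx : D (s, x) by move: dx; rewrite DE => -[].
have /subspace_continuousP/(_ _ dx) Pc := @sf_continuous _ _ Phi.
have GP : nbhs (Phi s x) G by apply: open_nbhs_nbhs.
have := Pc G GP; rewrite /nbhs/= /fmap /within /=.
have nD : nbhs (s, x) D by apply: open_nbhs_nbhs.
apply: (filterS2 _ _ nD) => p Dp pG p0.
have dp : sf_dom T p by rewrite DE.
by split; [case: dp|exact: pG].
Qed.

Lemma flow_near_point (s : R) (x : X) (G : set X) :
  0 <= s -> (s%:E < T x)%E -> open G -> G (Phi s x) ->
  \forall y \near x, (s%:E < T y)%E /\ G (Phi s y).
Proof.
move=> s0 sT oG Gx; have [[A B] /= [As Bx] AB] := flow_near s0 sT oG Gx.
apply: filterS Bx => y By; apply: (AB (s, y)) => //; split => //=.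
exact: nbhs_singleton.
Qed.

Lemma flow_near_time (s : R) (x : X) (G : set X) :
  0 <= s -> (s%:E < T x)%E -> open G -> G (Phi s x) ->
  \forall r \near s, 0 <= r -> (r%:E < T x)%E /\ G (Phi r x).
Proof.
move=> s0 sT oG Gx; have [[A B] /= [As Bx] AB] := flow_near s0 sT oG Gx.
apply: filterS As => r Ar; apply: (AB (r, x)) => //; split => //=.
exact: nbhs_singleton.
Qed.

Lemma flow_tube (a b : R) (x : X) (G : set X) :
  0 <= a -> open G ->
  (forall s, a <= s <= b -> (s%:E < T x)%E /\ G (Phi s x)) ->
  \forall y \near x, forall s, a <= s <= b -> (s%:E < T y)%E /\ G (Phi s y).
Proof.
move=> a0 oG xG.
pose D := [set p : R * X | 0 <= p.1 -> (p.1%:E < T p.2)%E /\ G (Phi p.1 p.2)].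
have := @tube_nbhs R X a b D° x (@open_interior _ D).
have h s : a <= s <= b -> D° (s, x).
  move=> sab; have [sT Gs] := xG s sab; apply: flow_near => //.
  by case/andP: sab => /(le_trans a0).
move=> /(_ h); apply: filterS => y yD s sab.
have := yD s sab; move/interior_subset; apply.
by case/andP: sab => /(le_trans a0).
Qed.

Variables (N E : set X).
Hypothesis pairNE : wazewski_pair Phi N E.
Hypothesis transNE : transversal_pair Phi N E.
Hypothesis E_sub_N : E `<=` N.

Definition hitting_time (x : X) : \bar R := ereal_inf
  [set s%:E | s in [set s | [/\ 0 <= s, (s%:E < T x)%E & E (Phi s x)]]].
Local Notation tau := hitting_time.

Lemma hitting_time_ge0 x : (0 <= tau x)%E.
Proof. by apply: le_ereal_inf_tmp => _ [s [s0 _ _] <-]; rewrite lee_fin. Qed.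

Lemma hitting_time_le x s :
  0 <= s -> (s%:E < T x)%E -> E (Phi s x) -> (tau x <= s%:E)%E.
Proof. by move=> s0 sT Es; apply: ereal_inf_lbound; exists s. Qed.

(** The orbit cannot leave [N] without meeting [E], an exit set, and cannot end before meeting [E],
    by strong admissibility. *)
Lemma before_hitting_time x s : N x -> 0 <= s -> (s%:E < tau x)%E ->
  (s%:E < T x)%E /\ (N `\` E) (Phi s x).
Proof.
move=> Nx s0 stau.
have nE r : 0 <= r -> r <= s -> (r%:E < T x)%E -> ~ E (Phi r x).
  move=> r0 rs rT /(hitting_time_le r0 rT) tr.
  by move: stau; rewrite ltNge (le_trans tr)// lee_fin.
have [_ _ [_ exE] [_ sadm]] := pairNE.
have lt_exit t : 0 <= t -> (t%:E < exit_time Phi N x)%E ->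
    (t%:E < T x)%E /\ N (Phi t x).
  move=> t0 te; split.
    rewrite ltNge; apply/negP => Tt; move: te; rewrite ltNge => /negP; apply.
    by apply: ereal_inf_lbound; exists t => //; split => //; left.
  apply: contrapT => nN; move: te; rewrite ltNge => /negP; apply.
  by apply: ereal_inf_lbound; exists t => //; split => //; right.
have se : (s%:E < exit_time Phi N x)%E.
  rewrite ltNge; apply/negP => es.
  have [eT|Te] := ltP (exit_time Phi N x) (T x).
    have [t [t0 te Et]] := exE x Nx eT.
    apply: (nE t) => //; last exact: le_lt_trans eT.
    by rewrite -lee_fin (le_trans te).
  (* Here the orbit would stay in [N] minus [E] and yet end by the finite time [s]. *)
  have Too : T x = +oo%E.
    apply: sadm => t t0 tT; apply: subset_closure.
    have [_ Nt] := lt_exit t t0 (lt_le_trans tT Te).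
    split => //; apply: nE => //.
    by rewrite -lee_fin; exact: (le_trans (ltW tT) (le_trans Te es)).
  by have := le_trans Te es; rewrite Too.
have [sT Ns] := lt_exit s s0 se.
by split => //; split => //; exact: nE.
Qed.

Lemma hitting_time_attained x s : tau x = s%:E ->
  [/\ 0 <= s, (s%:E < T x)%E & E (Phi s x)].
Proof.
move=> xs.
have s0 : 0 <= s by rewrite -lee_fin -xs hitting_time_ge0.
(* The infimum being finite, some hitting time [r >= s] exists, whence [s < T x]. *)
have [r [[r0 rT Er] sr]] : exists r,
    [/\ 0 <= r, (r%:E < T x)%E & E (Phi r x)] /\ s <= r.
  apply: contrapT => nr.
  have : (+oo <= tau x)%E.
    apply: le_ereal_inf_tmp => _ [r rE <-]; exfalso; apply: nr; exists r.
    split => //; case: rE => r0 rT Er.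
    by rewrite -lee_fin -xs; exact: hitting_time_le.
  by rewrite xs.
have sT : (s%:E < T x)%E by apply: le_lt_trans rT; rewrite lee_fin.
split => //; apply: contrapT => nE.
have [_ cE _ _] := pairNE.
have /nbhs_ballP[e /= e0 eE] := flow_near_time s0 sT (closed_openC cE) nE.
suff : ((s + e)%:E <= tau x)%E by rewrite xs lee_fin; lra.
apply: le_ereal_inf_tmp => _ [q [q0 qT Eq] <-]; rewrite lee_fin.
have sq : s <= q by rewrite -lee_fin -xs; exact: hitting_time_le.
rewrite leNgt; apply/negP => qse.
have sqe : ball s e q by rewrite /ball/= ltr_distlC; apply/andP; split; lra.
by have [_] := eE q sqe q0; apply.
Qed.

(** Lower semicontinuity: up to time [c] the orbit lies in the open complement of [E], and by
    compactness of the time interval so do nearby orbits. *)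
Lemma hitting_time_gt_near x (c : R) : N x -> (c%:E < tau x)%E ->
  \forall y \near x, N y -> (c%:E < tau y)%E.
Proof.
move=> Nx ct.
have [c0|c0] := ltP c 0.
  apply: nearW => y _; apply: (lt_le_trans _ (hitting_time_ge0 y)).
  by rewrite lte_fin.
have [_ cE _ _] := pairNE.
have := @flow_tube 0 c x (~` E) (lexx 0) (closed_openC cE).
have h s : 0 <= s <= c -> (s%:E < T x)%E /\ (~` E) (Phi s x).
  move=> /andP[s0 sc].
  have [sT [_ nE]] : (s%:E < T x)%E /\ (N `\` E) (Phi s x).
    by apply: before_hitting_time => //; apply: le_lt_trans ct; rewrite lee_fin.
  by split.
move=> /(_ h); apply: filterS => y yE Ny.
have := hitting_time_ge0 y.
case ty : (tau y) => [r| |] //; last by rewrite ltry.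
have [r0 rT Er] := hitting_time_attained ty.
rewrite lte_fin ltNge => _; apply/negP => rc.
by have [|_] := yE r; [rewrite r0|apply].
Qed.

(** Upper semicontinuity, where transversality enters. It suffices to find a time [r < c] at which
    the orbit is interior to the complement of [N] minus [E]: by [before_hitting_time], nearby
    points of [N] have then met [E] by time [r]. *)
Lemma hitting_time_lt_near x (c : R) : N x -> (tau x < c%:E)%E ->
  \forall y \near x, N y -> (tau y < c%:E)%E.
Proof.
move=> Nx xc; have := hitting_time_ge0 x.
move: xc; case ts : (tau x) => [s| |] //; rewrite lte_fin => sc _.
have [s0 sT Es] := hitting_time_attained ts.
have [cN cE [posE _] _] := pairNE.
pose H := closure (N `\` E).
suff [r [sr rc rT] [G [oG Gr GN]]] :
    exists2 r, [/\ s <= r, r < c & (r%:E < T x)%E] & exists G, [/\ open G, G (Phi r x) & G `<=` ~` (N `\` E)].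
  have r0 := le_trans s0 sr.
  apply: filterS (flow_near_point r0 rT oG Gr) => y [ry Gy] Ny.
  apply: (@le_lt_trans _ _ r%:E); last by rewrite lte_fin.
  rewrite leNgt; apply/negP => rtau.
  by have [_] := before_hitting_time Ny r0 rtau; exact: GN.
have oH : open (~` H) by exact/closed_openC/closed_closure.
have HN : ~` H `<=` ~` (N `\` E) by apply: subsetC; exact: subset_closure.
have [Hs|nHs] := pselect (H (Phi s x)); last first.
  by exists s => //; exists (~` H).
(* The axioms only give [T x <= s + T (Phi s x)], possibly strictly, so the time
   supplied by transversality at [Phi s x] must also be kept below [T x - s]. *)
have [d d0 dE] : exists2 d, 0 < d &
    forall r, 0 < r < d -> s + r < c /\ ((s + r)%:E < T x)%E.
  move: sT; case Tx : (T x) => [t| |] //; rewrite ?lte_fin => st.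
    exists (Num.min (c - s) (t - s)); first by rewrite lt_min !subr_gt0 sc.
    move=> r; rewrite lt_min => /andP[r0 /andP[rc rt]].
    by rewrite lte_fin; split; lra.
  exists (c - s); first by rewrite subr_gt0.
  by move=> r /andP[r0 rc]; rewrite ltry; split => //; lra.
have [q [/andP[q0 qd] qT nHE]] := transNE (conj Hs Es) d0.
have sE r : 0 <= r <= q -> [/\ s <= s + r, s + r < c, ((s + r)%:E < T x)%E,
    Phi (s + r) x = Phi r (Phi s x) & (r%:E < T (Phi s x))%E].
  move=> /andP[r0 rq]; have [sqc sqT] := dE q (introT andP (conj q0 qd)).
  have srT : ((s + r)%:E < T x)%E.
    by apply: le_lt_trans sqT; rewrite lee_fin lerD2l.
  have [rT ->] : (r%:E < T (Phi s x))%E /\ Phi (s + r) x = Phi r (Phi s x).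
    by rewrite addrC in srT *; exact: sf_flowD.
  by split => //; [rewrite lerDl|lra].
(* If the orbit stays in [N] up to [q], positive invariance keeps it in [E], so transversality puts
   it outside [H]; otherwise it lies outside the closed set [N] at some time [r <= q]. *)
have [qN|] := pselect (forall r, 0 <= r <= q -> N (Phi r (Phi s x))).
  have [|s1 s2 s3 s4 s5] := sE q; first by rewrite ltW//=.
  have [||_ _ /(_ q)] := posE (Phi s x) q; first by split => //; exact: E_sub_N.
    by split => //; exact: ltW.
  rewrite ltW//= lexx => /(_ isT) Eq.
  exists (s + q) => //; exists (~` H); split => //; rewrite s4 => Hq.
  exact: nHE.
move=> /existsNP[r /not_implyP[rq nN]].
have [s1 s2 s3 s4 s5] := sE r rq.
exists (s + r) => //; exists (~` N); split; first exact: closed_openC.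
  by rewrite s4.
by apply: subsetC => y [].
Qed.

(** Truncating [t] at 0 extends the stopped flow continuously to all real times; [fine] loses
    nothing, the minimum being finite. *)
Definition stop_time (t : R) (x : X) : R :=
  fine (Order.min (Num.max t 0)%:E (tau x)).
Local Notation sigma := stop_time.

Lemma stop_timeE t x : (sigma t x)%:E = Order.min (Num.max t 0)%:E (tau x).
Proof.
rewrite /stop_time fineK// minEle; case: ifPn => // h.
rewrite ge0_fin_numE ?hitting_time_ge0//.
by move: h; rewrite -ltNge => /lt_trans; apply; rewrite ltry.
Qed.

Lemma stop_time_ge0 t x : 0 <= sigma t x.
Proof.
by rewrite -lee_fin stop_timeE le_min hitting_time_ge0 andbT lee_fin le_max lexx orbT.
Qed.

Lemma stop_time_dom t x : N x ->
  ((sigma t x)%:E < T x)%E /\ N (Phi (sigma t x) x).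
Proof.
move=> Nx; have : ((sigma t x)%:E <= tau x)%E by rewrite stop_timeE ge_min lexx orbT.
rewrite le_eqVlt => /orP[/eqP/esym/hitting_time_attained[_ ? /E_sub_N]//|h].
by have [? []] := before_hitting_time Nx (stop_time_ge0 t x) h.
Qed.

(** The two semicontinuities of the hitting time give the upper and the lower bound. *)
Lemma stop_time_near t x (e : R) : N x -> 0 < e ->
  \forall p \near (t, x), N p.2 -> `|sigma t x - sigma p.1 p.2| < e.
Proof.
move=> Nx e0.
have maxc : continuous (fun t : R => Num.max t 0).
  by move=> u; apply: continuous_max; [exact: cvg_id|exact: cvg_cst].
have nfst (P : set R) : nbhs t P -> nbhs (t, x) (fun p => P p.1).
  exact: (@cvg_fst _ _ (nbhs t) (nbhs x) _).
have nsnd (P : set X) : nbhs x P -> nbhs (t, x) (fun p => P p.2).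
  exact: (@cvg_snd _ _ (nbhs t) (nbhs x) _).
set s := sigma t x.
have hi : \forall p \near (t, x), N p.2 -> sigma p.1 p.2 < s + e.
  have : (Order.min (Num.max t 0)%:E (tau x) < (s + e)%:E)%E.
    by rewrite -stop_timeE lte_fin ltrDl.
  rewrite gt_min => /orP[].
    rewrite lte_fin => h; have := @cvgr_lt _ _ (nbhs t) (nbhs_filter t) _ _ (maxc t) _ h.
    move=> /nfst; apply: filterS => p /= pe _.
    by rewrite -lte_fin stop_timeE gt_min lte_fin pe.
  move=> /(hitting_time_lt_near Nx)/nsnd; apply: filterS => p /= h Np.
  by rewrite -lte_fin stop_timeE gt_min h ?orbT.
have lo : \forall p \near (t, x), N p.2 -> s - e < sigma p.1 p.2.
  have : ((s - e)%:E < Order.min (Num.max t 0)%:E (tau x))%E.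
    by rewrite -stop_timeE lte_fin; rewrite /s; lra.
  rewrite lt_min => /andP[].
  rewrite lte_fin => h; have := @cvgr_gt _ _ (nbhs t) (nbhs_filter t) _ _ (maxc t) _ h.
  move=> /nfst h1 /(hitting_time_gt_near Nx)/nsnd; apply: filterS2 h1 => p /= pe h2 Np.
  by rewrite -lte_fin stop_timeE lt_min lte_fin pe h2.
apply: filterS2 hi lo => p hi lo Np.
by rewrite ltr_distlC; apply/andP; split; [have := lo Np|have := hi Np]; lra.
Qed.

End hitting_time.

(** * Long-time behavior of the orbits that never meet [E] *)

Section stable_set.
Variables (R : realType) (X : metricType R) (Phi : local_semiflow R X).
Variables (N E : set X).
Hypothesis pairNE : wazewski_pair Phi N E.
Hypothesis transNE : transversal_pair Phi N E.
Hypothesis E_sub_N : E `<=` N.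
Local Notation T := (sf_time Phi).
Local Notation tau := (hitting_time Phi E).
Local Notation H := (closure (N `\` E)).

Definition stable_set : set X := [set x | N x /\ tau x = +oo%E].
Local Notation S := stable_set.

Lemma exit_closure_sub : H `<=` N.
Proof.
have [cN _ _ _] := pairNE; rewrite closureE => x; apply; split => // y [].
Qed.

Lemma stable_set_flow x t : S x -> 0 <= t ->
  (t%:E < T x)%E /\ (N `\` E) (Phi t x).
Proof.
by move=> [Nx xoo] t0; apply: (before_hitting_time pairNE) => //; rewrite xoo ltry.
Qed.

Lemma stable_set_time x : S x -> T x = +oo%E.
Proof.
move=> Sx; have [_ _ _ [_]] := pairNE; apply => t t0 _.
by apply: subset_closure; have [] := stable_set_flow Sx t0.
Qed.

Lemma flow_addition x s t : T x = +oo%E -> 0 <= s -> 0 <= t ->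
  Phi (t + s) x = Phi t (Phi s x).
Proof.
by move=> xoo s0 t0; have [] := @sf_flowD _ _ Phi t s x t0 s0; rewrite ?xoo ?ltry.
Qed.

Lemma stable_setP x :
  N x -> (forall t, 0 <= t -> (t%:E < T x)%E -> ~ E (Phi t x)) ->
  S x.
Proof.
move=> Nx nE; split => //; have := hitting_time_ge0 Phi E x.
case tx : (tau x) => [s| |] // _.
have [s0 sT Es] := hitting_time_attained pairNE tx.
by have := nE s s0 sT.
Qed.

Lemma stable_set_positive x t : S x -> 0 <= t -> S (Phi t x).
Proof.
move=> Sx t0; have [_ [Nt _]] := stable_set_flow Sx t0.
apply: stable_setP => // s s0 _; rewrite -flow_addition ?stable_set_time//.
by have [_ []] := stable_set_flow Sx (addr_ge0 s0 t0).
Qed.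

Lemma stable_set_closed : closed S.
Proof.
have [cN _ _ _] := pairNE.
rewrite -openC openE => x nSx.
have [Nx|nNx] := pselect (N x); last first.
  have : nbhs x (~` N) by apply: open_nbhs_nbhs; split => //; exact: closed_openC.
  by apply: filterS => y nN [].
have : (tau x < +oo)%E.
  by rewrite ltey; apply/eqP => xoo; apply: nSx.
have := hitting_time_ge0 Phi E x.
case tx : (tau x) => [s| |] // _ _.
have := @hitting_time_lt_near _ _ _ _ _ pairNE transNE E_sub_N x (s + 1) Nx.
rewrite tx lte_fin ltrDl => /(_ ltr01).
by apply: filterS => y h [Ny yoo]; have := h Ny; rewrite yoo.
Qed.

Lemma stable_set_disjoint x : S x -> ~ E x.
Proof.
by move=> Sx; have [_ []] := stable_set_flow Sx (lexx 0); rewrite sf_flow0.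
Qed.

(** If an orbit in [K] met [E], positive invariance would keep it in both [H] and [E], against
    transversality. *)
Lemma invariant_sub_stable K : invariant_set Phi K -> K `<=` H -> K `<=` S.
Proof.
move=> [Koo Kinv] KH x Kx.
have Kflow y t : K y -> 0 <= t -> K (Phi t y).
  by move=> Ky t0; rewrite -(Kinv t t0); exists y.
apply: stable_setP; first exact/exit_closure_sub/KH.
move=> t t0 _ Et; set z := Phi t x.
have Kz : K z by exact: Kflow.
have [s [/andP[s0 _] sT]] := transNE (conj (KH _ Kz) Et) ltr01.
apply; split; first exact/KH/Kflow/ltW.
have [_ _ [posE _] _] := pairNE.
have [||_ _ /(_ s)] := posE z s; first by split => //; exact: E_sub_N.
  split => //; first exact: ltW.
  by move=> r /andP[r0 _]; exact/exit_closure_sub/KH/Kflow.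
by rewrite ltW//= lexx; apply.
Qed.

Lemma stable_flow_near x t (G : set X) : S x -> 0 <= t -> open G ->
  G (Phi t x) -> \forall y \near x, G (Phi t y).
Proof.
move=> Sx t0 oG Gx.
have := @flow_near_point _ _ Phi t x G t0 _ oG Gx.
rewrite stable_set_time// ltry => /(_ isT).
by apply: filterS => y [].
Qed.

(** The positive prolongational limit set relative to [S]. Letting the starting point [y] vary near
    [x] makes the resulting attraction locally uniform. *)
Definition limit_set (x : X) : set X := [set z : X |
  forall V W (t : R), nbhs x V -> nbhs z W ->
  exists y s, [/\ V y, S y, t <= s & W (Phi s y)]].

Lemma limit_set_stable x : limit_set x `<=` S.
Proof.
move=> z xz; apply: stable_set_closed => W zW.
have [y [s [_ Sy s0 Ws]]] := xz _ _ 0 filterT zW.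
by exists (Phi s y); split => //; exact: stable_set_positive.
Qed.

Lemma limit_set_closed x : closed (limit_set x).
Proof.
move=> z zQ V W t xV; rewrite nbhsE => -[W' [oW' W'z] W'W].
have [u [Qu W'u]] := zQ W' (open_nbhs_nbhs (conj oW' W'z)).
have [y [s [Vy Sy ts Ws]]] := Qu V W' t xV (open_nbhs_nbhs (conj oW' W'u)).
by exists y, s; split => //; exact: W'W.
Qed.

Lemma cvg_shrinking_balls (x : X) (y : nat -> X) :
  (forall n, ball x n.+1%:R^-1 (y n)) -> y @ \oo --> x.
Proof.
move=> xy; apply/cvg_ballP => e e0.
have := near_infty_natSinv_lt (PosNum e0); apply: filterS => n /= ne.
exact: le_ball (ltW ne) _ (xy n).
Qed.

Lemma increasing_seq_cvg (k : nat -> nat) : increasing_seq k -> k @ \oo --> \oo.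
Proof.
move=> kinc P [n _ nP]; exists n => // m /= nm; apply: nP => /=.
apply: (leq_trans nm); elim: m {nm} => // m IH; apply: (leq_ltn_trans IH).
by have := leqW_mono kinc m m.+1; rewrite ltnS leqnn => ->.
Qed.

(** Asymptotic compactness: orbits from [S] stay in [H], which is admissible. *)
Lemma limit_set_subseq x (y : nat -> X) (t : nat -> R) :
  (forall n, S (y n)) -> (forall n, ball x n.+1%:R^-1 (y n)) ->
  (forall n, n%:R <= t n) ->
  exists k z, [/\ increasing_seq k, limit_set x z &
    (fun n => Phi (t (k n)) (y (k n))) @ \oo --> z].
Proof.
move=> Sy xy nt; have [_ _ _ [adm _]] := pairNE.
have toy : t @ \oo --> +oo.
  apply/cvgryPge => A.
  have := nbhs_infty_ger A; apply: filterS => n /= An.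
  exact: le_trans (nt n).
have t0 n : 0 <= t n by apply: le_trans (nt n).
have [n|k [z [kinc kz]]] := adm y t toy.
  split => //; first by have [] := stable_set_flow (Sy n) (t0 n).
  move=> s /andP[s0 _]; apply: subset_closure.
  by have [] := stable_set_flow (Sy n) s0.
exists k, z; split => // V W a xV zW.
have kV : \forall n \near \oo, V (y (k n)).
  exact: (cvg_comp _ _ (increasing_seq_cvg kinc) (cvg_shrinking_balls xy)).
have kt : \forall n \near \oo, a <= t (k n).
  have ta : \forall n \near \oo, a <= t n by move/cvgryPge : toy.
  exact: (increasing_seq_cvg kinc ta).
have := filterI kV (filterI kt (kz _ zW)).
move=> [n _ /(_ n (leqnn n))[Vn [an Wn]]].
by exists (y (k n)), (t (k n)).
Qed.

Lemma limit_set_invariant x : invariant_set Phi (limit_set x).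
Proof.
split; first by move=> z /limit_set_stable/stable_set_time.
move=> t t0; apply/seteqP; split => [_ [z Qz <-] V W a xV|z Qz].
  rewrite nbhsE => -[W' [oW' W'z] W'W].
  have Sz := limit_set_stable Qz.
  have [y [s [Vy Sy ms Ws]]] :=
    Qz V _ (Num.max a 0) xV (stable_flow_near Sz t0 oW' W'z).
  have s0 : 0 <= s by apply: le_trans ms; rewrite le_max lexx orbT.
  exists y, (t + s); split => //.
    by apply: (@le_trans _ _ s); [apply: le_trans ms; rewrite le_max lexx|rewrite lerDr].
  by rewrite flow_addition ?stable_set_time//; exact: W'W.
have /choice[ys Hys] : forall n : nat, exists ys : X * R,
    [/\ S ys.1, ball x n.+1%:R^-1 ys.1, n%:R <= ys.2 &
        ball z n.+1%:R^-1 (Phi t (Phi ys.2 ys.1))].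
  move=> n; have n0 : 0 < n.+1%:R^-1 :> R by [].
  have [y [s [Vy Sy ns Ws]]] :=
    Qz _ _ (n%:R + t) (nbhsx_ballx x _ n0) (nbhsx_ballx z _ n0).
  (* Backing up by [t] yields points that subconverge to some [w] with [Phi t w = z]. *)
  exists (y, s - t); split => //=; first by rewrite lerBrDr.
  have st : 0 <= s - t by rewrite subr_ge0; apply: le_trans ns; rewrite lerDr.
  by rewrite -flow_addition ?stable_set_time// addrC subrK.
have [k [w [kinc Qw kw]]] := @limit_set_subseq x (fun n => (ys n).1)
  (fun n => (ys n).2) (fun n => let: And4 a _ _ _ := Hys n in a)
  (fun n => let: And4 _ a _ _ := Hys n in a)
  (fun n => let: And4 _ _ a _ := Hys n in a).
exists w => //.
have zlim : (fun n => Phi t (Phi (ys (k n)).2 (ys (k n)).1)) @ \oo --> z.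
  apply: (@cvg_comp _ _ _ k (fun n => Phi t (Phi (ys n).2 (ys n).1)) _ _ _
    (increasing_seq_cvg kinc)).
  by apply: cvg_shrinking_balls => n; have [] := Hys n.
suff wlim : (fun n => Phi t (Phi (ys (k n)).2 (ys (k n)).1)) @ \oo --> Phi t w.
  exact: (cvg_unique (@metric_hausdorff _ X) wlim zlim).
move=> G; rewrite nbhsE => -[G' [oG' G'w] G'G].
have h : \forall n \near \oo, G' (Phi t (Phi (ys (k n)).2 (ys (k n)).1)).
  exact: (kw _ (stable_flow_near (limit_set_stable Qw) t0 oG' G'w)).
by near do apply: G'G.
Unshelve. all: by end_near.
Qed.

Definition uniformly_eventually (x : X) (G : set X) :=
  \forall y \near x & t \near +oo, S y -> G (Phi t y).

(** Otherwise points of [S] tending to [x] are outside [G] at arbitrarily late times, and these late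
    positions subconverge to a point of the limit set, inside the open set [G]. *)
Lemma limit_set_attracts x (G : set X) : open G -> limit_set x `<=` G ->
  uniformly_eventually x G.
Proof.
move=> oG QG; apply: contrapT => nG.
have /choice[ys Hys] : forall n : nat, exists ys : X * R,
    [/\ S ys.1, ball x n.+1%:R^-1 ys.1, n%:R <= ys.2 & ~ G (Phi ys.2 ys.1)].
  move=> n; apply: contrapT => /forallNP h; apply: nG.
  exists (ball x n.+1%:R^-1, [set t | n%:R < t]) => /=.
    split; first exact: nbhsx_ballx.
    by exists n%:R; split => //; exact: num_real.
  move=> [y t] /= [xy nt] Sy; apply: contrapT => nGt.
  by apply: (h (y, t)); split => //; exact: ltW.
have [k [w [kinc Qw kw]]] := @limit_set_subseq x (fun n => (ys n).1)
  (fun n => (ys n).2) (fun n => let: And4 a _ _ _ := Hys n in a)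
  (fun n => let: And4 _ a _ _ := Hys n in a)
  (fun n => let: And4 _ _ a _ := Hys n in a).
have [n _ /(_ n (leqnn n))] := kw G (open_nbhs_nbhs (conj oG (QG w Qw))).
by have [] := Hys (k n).
Qed.

Local Notation K := (max_invariant_set Phi H).

Lemma limit_set_sub_max x : limit_set x `<=` K.
Proof.
move=> z Qz; exists (limit_set x) => //; split; first exact: limit_set_invariant.
move=> u /limit_set_stable Su; apply: subset_closure.
by have [] := stable_set_flow Su (lexx 0); rewrite sf_flow0.
Qed.

Lemma max_invariant_sub_stable : K `<=` S.
Proof. by move=> x [L [Linv LH] Lx]; exact: (invariant_sub_stable Linv LH). Qed.

(* Every point outside the closed set [S] belongs to it, vacuously. *)
Definition attracted_set (A : set X) : set X :=
  [set x | forall G, open G -> A `<=` G -> uniformly_eventually x G].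

Lemma attracted_set_max x : attracted_set K x.
Proof.
move=> G oG KG; apply: limit_set_attracts => //.
exact: subset_trans (@limit_set_sub_max x) KG.
Qed.

Lemma unstable_eventually x G : ~ S x -> uniformly_eventually x G.
Proof.
move=> nSx; exists (~` S, setT) => /=.
  split; last exact: filterT.
  by apply: open_nbhs_nbhs; split => //; exact: closed_openC stable_set_closed.
by move=> [y t] /= [].
Qed.

Lemma uniformly_eventually0 x : uniformly_eventually x set0 -> ~ S x.
Proof.
move=> [[A B] /= [xA [M [_ MB]]] AB] Sx.
apply: (AB (x, M + 1)) => //; split => /=; first exact: nbhs_singleton.
by apply: MB; rewrite ltrDl.
Qed.

Lemma uniformly_eventually_open G : open [set x | uniformly_eventually x G].
Proof.
rewrite openE => x [[A B] /= [xA ooB] AB].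
move: xA; rewrite nbhsE => -[A' [oA' A'x] A'A].
apply: (@filterS _ (nbhs x) _ A'); last exact: open_nbhs_nbhs.
move=> y A'y; exists (A', B) => /=; first by split => //; exact: open_nbhs_nbhs.
by move=> [z t] /= [/A'A Az Bt]; exact: (AB (z, t)).
Qed.

(** A neighborhood of [Phi t x] pulls back to one of [x], and the time threshold grows by [t]. *)
Lemma attracted_set_preflow A x t : S x -> 0 <= t ->
  attracted_set A (Phi t x) -> attracted_set A x.
Proof.
move=> Sx t0 Ax G oG AG; have [[V B] /= [nV [M [_ MB]]] VB] := Ax G oG AG.
move: nV; rewrite nbhsE => -[V' [oV' V'x] V'V].
exists ([set y | V' (Phi t y)], [set s | Num.max M 0 + t < s]) => /=.
  split; first exact: stable_flow_near.
  by exists (Num.max M 0 + t); split => //; exact: num_real.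
move=> [y s] /= [V'y]; rewrite -ltrBrDr gt_max => /andP[Ms s0] Sy.
rewrite -(subrK t s) flow_addition ?stable_set_time//; last exact: ltW.
apply: (VB (Phi t y, s - t)) => /=; last exact: stable_set_positive.
by split; [exact: V'V|exact: MB].
Qed.

Section attractor.
Variable A : set X.
Hypothesis attrA : attractor_in Phi K A.
Hypothesis kK : compact K.

(** Eventual containment in [U] forces attraction by [A]: the limit set is then a compact invariant
    subset of [closure U] and of [K], hence of the neighborhood [UK] in which [A] is maximal. *)
Lemma attractor_trap : exists U UK : set X, [/\ open U, A `<=` U,
  closure U `&` K `<=` UK, attracts_in Phi K A UK &
  forall x, uniformly_eventually x U -> attracted_set A x].
Proof.
have [A0 kA invA AK [UK [[UKK UKn] attrUK maxA]]] := attrA.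
pose O1 := [set x | K x -> UK x]°.
have AO1 : A `<=` O1 by move=> x Ax; have := UKn x Ax; rewrite /within/=; apply.
have cA : closed A by apply: compact_closed => //; exact: metric_hausdorff.
have [U [oU AU UO1]] := metric_closed_open_shrink cA (@open_interior _ _) AO1.
have UKU : closure U `&` K `<=` UK by move=> x [/UO1/interior_subset].
exists U, UK; split => // x evU G oG AG; apply: limit_set_attracts => //.
apply: subset_trans AG; apply: maxA.
- apply: (subclosed_compact (@limit_set_closed x) kK).
  exact: limit_set_sub_max.
- exact: limit_set_invariant.
- move=> z Qz; apply: UKU; split; last exact: limit_set_sub_max Qz.
  have [[V B] /= [xV [M [_ MB]]] VB] := evU.
  move=> W zW; have [y [s [Vy Sy Ms Ws]]] := Qz V W (M + 1) xV zW.
  exists (Phi s y); split => //; apply: (VB (y, s)) => //; split => //=.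
  by apply: MB; apply: lt_le_trans Ms; rewrite ltrDl.
Qed.

Lemma attracted_set_open : open (attracted_set A).
Proof.
have [U [UK [oU AU _ _ trap]]] := attractor_trap.
suff -> : attracted_set A = [set x | uniformly_eventually x U].
  exact: uniformly_eventually_open.
by apply/seteqP; split => x; [exact|exact: trap].
Qed.

(** Attraction of the single orbit of [x] in [K] must be made uniform over nearby points of [S],
    which may lie outside [K]. Near the limit set, points of [U] are back in [U] after time [m]; so
    an orbit that spends a late enough window of length [m] in [U] remains there. *)
Lemma attraction_basin_sub : attraction_basin Phi K A `<=` attracted_set A.
Proof.
have [U [UK [oU AU UKU attrUK trap]]] := attractor_trap.
have [_ _ _ AK _] := attrA.
have UKnbhd : nbhd_in K A (U `&` K).
  split; first by move=> x [].
  move=> x Ax; rewrite /within/=; have : nbhs x U.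
    by apply: open_nbhs_nbhs; split => //; exact: AU.
  by apply: filterS => y Uy Ky.
move=> x [Kx [_ xA]]; apply: trap.
have [a a0 xU] := xA _ UKnbhd.
have [b b0 UKb] := attrUK.2 _ UKnbhd.
(* [m > b] brings [UK] into [U] at time [m], and [m >= 1] lets the multiples of [m] exceed any
   time. *)
pose m := b + 1.
have m0 : 0 <= m by rewrite /m; lra.
have Sx := max_invariant_sub_stable Kx.
(* A limit point in [closure U] is sent into the open set [U] at time [m]; near any other limit
   point the premise [U z] fails. *)
have step : uniformly_eventually x [set z | U z -> U (Phi m z)]°.
  apply: limit_set_attracts; first exact: open_interior.
  move=> z Qz; rewrite /interior/=.
  have Kz := limit_set_sub_max Qz; have Sz := limit_set_stable Qz.
  have [Uz|nUz] := pselect (closure U z); last first.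
    have : nbhs z (~` closure U).
      by apply: open_nbhs_nbhs; split => //; exact/closed_openC/closed_closure.
    by apply: filterS => u nU /(@subset_closure _ U u).
  have [Um _] : (U `&` K) (Phi m z).
    apply: (UKb m); first by rewrite /m ltrDl.
    by exists z => //; apply: UKU.
  by apply: filterS (stable_flow_near Sz m0 oU Um) => u /= ? _.
have [[V B] /= [xV [M [_ MB]]] VB] := step.
(* From time [c] on, [step] applies and the orbit of [x] lies in [U]. *)
pose c := Num.max (M + 1) (a + 1).
have c0 : 0 <= c by rewrite le_max; apply/orP; right; lra.
have tube : forall s, c <= s <= c + m -> (s%:E < T x)%E /\ U (Phi s x).
  move=> s /andP[cs _]; split; first by rewrite stable_set_time// ltry.
  have [] : (U `&` K) (Phi s x); last by [].
  apply: (xU s); last by exists x.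
  by apply: lt_le_trans cs; rewrite lt_max ltrDl ltr01 orbT.
exists ([set y | forall s, c <= s <= c + m -> (s%:E < T y)%E /\ U (Phi s y)] `&` V,
  [set s | c < s]) => /=.
  split; first by apply: filterI => //; exact: flow_tube.
  by exists c; split => //; exact: num_real.
move=> [y t] /= [[yU Vy] ct] Sy.
have induct n : forall s, c <= s <= c + m *+ n.+1 -> U (Phi s y).
  elim: n => [|n IH] s /andP[cs sn]; first by apply yU; rewrite cs.
  have [sm|sm] := leP s (c + m); first by apply yU; rewrite cs.
  have Us : U (Phi (s - m) y).
    by apply: IH; apply/andP; split; [lra|rewrite mulrS in sn; lra].
  rewrite -(subrK m s) addrC flow_addition ?stable_set_time//; last by lra.
  have VBs : (V `*` B) (y, s - m).
    split => //=; apply: MB.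
    have : M + 1 <= c by rewrite le_max lexx.
    by lra.
  exact: interior_subset (VB (y, s - m) VBs Sy) Us.
apply: (induct (Num.truncn (t - c))); rewrite (ltW ct)/=.
have tc : 0 <= t - c by rewrite subr_ge0 ltW.
have := truncnS_gt (t - c); rewrite -lerBlDl => h; apply: (le_trans (ltW h)).
by rewrite -[leRHS]mulr_natl ler_peMr// /m; lra.
Qed.

End attractor.

End stable_set.

(** * Relative category is a minimum or infinite *)

Section category_values.
Variables (R : realType) (Z : topologicalType).
Implicit Types Y A : set Z.

Lemma rel_category_attained Y A : rel_category R Y A = +oo%E \/
  exists2 m, cat_cover R Y A m & rel_category R Y A = m%:R%:E.
Proof.
have [[m0 cm0]|nc] := pselect (exists m, cat_cover R Y A m).
  have ex : exists m, `[< cat_cover R Y A m >] by exists m0; apply/asboolP.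
  right; case: (ex_minnP ex) => m /asboolP cm mmin; exists m => //.
  apply/eqP; rewrite eq_le; apply/andP; split.
    by apply: ereal_inf_lbound; exists m.
  apply: le_ereal_inf_tmp => _ [k ck <-]; rewrite lee_fin ler_nat.
  exact/mmin/asboolP.
left; rewrite /rel_category.
suff -> : [set m%:R%:E | m in cat_cover R Y A] = set0 :> set (\bar R).
  by rewrite ereal_inf0.
by apply/seteqP; split => // x [m cm _]; apply: nc; exists m.
Qed.

Lemma rel_category_ge0 Y A : (0 <= rel_category R Y A)%E.
Proof. by apply: le_ereal_inf_tmp => _ [m _ <-]; rewrite lee_fin. Qed.

End category_values.

(** * The flow on [N] stopped at the exit set *)

Section stopped_flow.
Variables (R : realType) (X : metricType R) (Phi : local_semiflow R X).
Variables (N E : set X).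
Hypothesis pairNE : wazewski_pair Phi N E.
Hypothesis transNE : transversal_pair Phi N E.
Hypothesis E_sub_N : E `<=` N.
Local Notation T := (sf_time Phi).
Local Notation tau := (hitting_time Phi E).
Local Notation sigma := (stop_time Phi E).
Local Notation S := (stable_set Phi N E).

(** By [stop_time_dom] the stopped orbit stays in [N], so [insubd] never falls back on its default
    [p.2]. *)
Definition stopped_flow (p : R * N) : N :=
  insubd p.2 (Phi (sigma p.1 (set_val p.2)) (set_val p.2)).
Local Notation Psi := stopped_flow.

Lemma stopped_flowE p :
  set_val (Psi p) = Phi (sigma p.1 (set_val p.2)) (set_val p.2).
Proof.
apply: insubdK; apply/mem_set.
by have [] := stop_time_dom pairNE E_sub_N p.1 (set_valP p.2).
Qed.

Lemma set_val_near (x : N) (P : set X) :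
  nbhs (set_val x) P -> nbhs x (set_val @^-1` P).
Proof. exact: (@initial_continuous N X set_val x). Qed.

Lemma stopped_flow_continuous : continuous Psi.
Proof.
move=> [t x] G [_ [[G' oG' <-] /= G'x] G'G].
apply: (filterS G'G).
rewrite /= stopped_flowE /= in G'x.
have Nx := set_valP x.
have [sT _] := stop_time_dom pairNE E_sub_N t Nx.
have [[A B] /= [/nbhs_ballP[e /= e0 eA] xB] AB] :=
  flow_near (stop_time_ge0 Phi E t _) sT oG' G'x.
have [[C D] /= [tC xD] CD] := stop_time_near pairNE transNE E_sub_N t Nx e0.
exists (C, set_val @^-1` (B `&` D)) => /=.
  by split => //; apply: set_val_near; exact: filterI.
move=> [s y] /= [Cs [By Dy]]; rewrite stopped_flowE/=.
have [||_ //] := AB (sigma s (set_val y), set_val y); last exact: stop_time_ge0.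
split => //=; apply: eA; rewrite /ball/=.
exact: (CD (s, set_val y)) (set_valP y).
Qed.

Lemma stopped_flow0 x : Psi (0, x) = x.
Proof.
apply: val_inj; rewrite [LHS]stopped_flowE/=.
have -> : sigma 0 (set_val x) = 0.
  apply: EFin_inj; rewrite stop_timeE maxxx.
  by apply/min_idPl; exact: hitting_time_ge0.
exact: sf_flow0.
Qed.

Lemma stopped_flow_exit t x : E (set_val x) -> Psi (t, x) = x.
Proof.
move=> Ex; apply: val_inj; rewrite [LHS]stopped_flowE/=.
have -> : sigma t (set_val x) = 0.
  apply/eqP; rewrite eq_le stop_time_ge0 andbT -lee_fin stop_timeE ge_min.
  by rewrite hitting_time_le ?orbT ?sf_flow0// sf_time_gt0.
exact: sf_flow0.
Qed.

Lemma stopped_flow_stable t x : S (set_val x) -> 0 <= t ->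
  set_val (Psi (t, x)) = Phi t (set_val x).
Proof.
move=> [_ xoo] t0; rewrite stopped_flowE/=; congr (Phi _ _).
apply: EFin_inj; rewrite stop_timeE xoo (max_idPl t0).
by apply/min_idPl; rewrite leey.
Qed.

(** Stopping occurs no later than any meeting with [E], so a meeting at time [r] is still ahead of
    the stopped point, at time [r - s]. *)
Lemma stopped_flow_unstable t x : ~ S (set_val x) -> ~ S (set_val (Psi (t, x))).
Proof.
have Nx := set_valP x.
move=> nSx Sy; apply: nSx; apply: (stable_setP pairNE) => // r r0 rT Er.
set s := sigma t (set_val x) in Sy *.
have s0 : 0 <= s := stop_time_ge0 Phi E t _.
rewrite stopped_flowE /= -/s in Sy.
have sr : s <= r.
  rewrite -lee_fin stop_timeE ge_min; apply/orP; right.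
  exact: hitting_time_le.
have rs0 : 0 <= r - s by rewrite subr_ge0.
have rsT : ((r - s + s)%:E < T (set_val x))%E by rewrite subrK.
have [_ [_]] := stable_set_flow pairNE Sy rs0.
by have [_ <-] := sf_flowD rs0 s0 rsT; rewrite subrK.
Qed.

(** By upper semicontinuity the hitting times near [x] are below that of [x] plus 1, and after its
    hitting time a point rests in [E]. *)
Lemma stopped_flow_reaches_exit x : ~ S (set_val x) ->
  \forall y \near x & t \near +oo, E (set_val (Psi (t, y))).
Proof.
have Nx := set_valP x => nSx.
have : (tau (set_val x) < +oo)%E.
  by rewrite ltey; apply/eqP => xoo; exact: nSx.
have := hitting_time_ge0 Phi E (set_val x).
case tx : (tau (set_val x)) => [s| |] // s0 _.
have := @hitting_time_lt_near _ _ _ _ _ pairNE transNE E_sub_N _ (s + 1) Nx.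
rewrite tx lte_fin ltrDl => /(_ ltr01) /set_val_near xs.
exists (set_val @^-1` [set y | N y -> (tau y < (s + 1)%:E)%E], [set t | s + 1 < t]) => /=.
  by split => //; exists (s + 1); split => //; exact: num_real.
move=> [y t] /= [/(_ (set_valP y)) ys st].
have := hitting_time_ge0 Phi E (set_val y).
case ty : (tau (set_val y)) => [r| |]; rewrite ?ty// in ys * => r0.
have [_ _ Er] := hitting_time_attained pairNE ty.
rewrite stopped_flowE /=.
have -> // : sigma t (set_val y) = r.
apply: EFin_inj; rewrite stop_timeE ty; apply/min_idPr.
rewrite lee_fin le_max; apply/orP; left.
by move: ys; rewrite lte_fin => /ltW /le_trans; apply; exact: ltW.
Qed.

End stopped_flow.

(** * Application to the filtration given by the Morse decomposition *)

Theorem theorem1p1 (R : realType) (X : metricType R)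
  (X_complete : complete_space X) (Phi : local_semiflow R X) (N E : set X)
  (NE_pair : wazewski_pair Phi N E) (NE_transversal : transversal_pair Phi N E)
  (E_sub_N : E `<=` N) (n : nat) (M : 'I_n -> set X)
  (M_morse :
    morse_decomposition Phi (max_invariant_set Phi (closure (N `\` E))) M)
  (N_ANE : ANE (N : metricType R)) :
  (rel_category R (set_val @^-1` E : set N) [set: N]
    <= \sum_(i < n) category R (set_val @^-1` M i : set N))%E.
Proof.
set K := max_invariant_set Phi (closure (N `\` E)) in M_morse.
have [A [A0 An Alt attrA ME]] := M_morse.
pose YE : set N := set_val @^-1` E.
pose D k := A k.+1 `\` attraction_basin Phi K (A k).
(* One infinite term makes the sum infinite, the other terms being nonnegative. *)
have [[i iy]|/forallNP nfin] :=
  pselect (exists i, category R (set_val @^-1` M i : set N) = +oo%E).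
  suff -> : (\sum_(i < n) category R (set_val @^-1` M i : set N) = +oo)%E.
    by rewrite leey.
  rewrite (bigD1 i)//= iy addye// gt_eqF//; apply: (lt_le_trans ltNy0).
  by apply: sume_ge0 => j _; exact: rel_category_ge0.
have /choice[m Hm] : forall k : nat, exists m, (k < n)%N ->
    cat_cover R set0 (set_val @^-1` D k : set N) m /\
    category R (set_val @^-1` D k : set N) = m%:R%:E.
  move=> k; have [kn|kn] := ltnP k n; last by exists 0%N.
  have := nfin (Ordinal kn); rewrite ME /= => catoo.
  have [//|[m cm me]] :=
    rel_category_attained R set0 (set_val @^-1` D k : set N).
  by exists m.
have -> : (\sum_(i < n) category R (set_val @^-1` M i : set N) =
    (\sum_(0 <= i < n) m i)%N%:R%:E)%E.
  rewrite big_mkord natr_sum -sumEFin; apply: eq_bigr => i _.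
  by rewrite ME; have [] := Hm i (ltn_ord i).
apply: ereal_inf_lbound; exists (\sum_(0 <= i < n) m i)%N => //.
pose S := stable_set Phi N E.
have AS k : (k <= n)%N -> A k `<=` S.
  case: k => [|k] kn; first by rewrite A0.
  have [_ _ _ AK _] := attrA k.+1 kn.
  exact: subset_trans AK (max_invariant_sub_stable NE_pair NE_transversal E_sub_N).
(* [A n = K] is an attractor as soon as [n > 0], hence compact. *)
have kK k : (k < n)%N -> compact K.
  move=> kn; have n0 : (0 < n)%N by exact: leq_ltn_trans kn.
  by have [_ + _ _ _] := attrA n (introT andP (conj n0 (leqnn n))); rewrite An.
pose attr k := attracted_set Phi N E (A k).
have oattr k : (k < n)%N -> open (attr k).
  case: k => [|k] kn.
    (* [A 0] is empty: attraction to it means having no point of [S] nearby. *)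
    have -> : attr 0%N = ~` S.
      apply/seteqP; split => x.
        move=> /(_ set0 open0); rewrite A0 => /(_ (@subset_refl _ _)).
        exact: uniformly_eventually0.
      by move=> nSx G _ _; exact: unstable_eventually.
    exact/closed_openC/stable_set_closed.
  apply: attracted_set_open => //; [|exact: (kK _ kn)].
  by apply: attrA; exact: ltnW.
have unstable_attr k x : ~ S x -> attr k x.
  by move=> nSx G _ _; exact: unstable_eventually.
have basin_attr k : (k < n)%N -> attraction_basin Phi K (A k) `<=` attr k.
  case: k => [|k] kn.
    (* The basin of the empty set is empty: its neighborhood [set0] would have to contain late
       points of the orbit. *)
    move=> x [_ [_]]; rewrite A0 => /(_ set0)[]; first by split.
    by move=> t t0 /(_ (t + 1)); rewrite ltrDl => /(_ ltr01 (Phi (t + 1) x)) [] //; exists x.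
  apply: attraction_basin_sub => //; [|exact: (kK _ kn)].
  by apply: attrA; exact: ltnW.
apply: (@cat_cover_filtration R N N_ANE (stopped_flow Phi E) YE _ _ _ _
  (fun k => set_val @^-1` attr k) (fun k => set_val @^-1` D k) m n).
- exact: stopped_flow_continuous.
- exact: stopped_flow0.
- apply: preimage_closed; last by case: NE_pair.
  by move=> x _; exact: initial_continuous.
- by move=> t x _; exact: stopped_flow_exit.
- move=> k kn; have := oattr k kn; apply: open_comp => x _.
  exact: initial_continuous.
- move=> k kn x Ex; apply: unstable_attr => Sx.
  by have := stable_set_disjoint NE_pair Sx; apply.
- move=> k t x kn t0 /=.
  have [Sx|nSx] := pselect (S (set_val x)); last by move=> _; exact: unstable_attr.
  rewrite stopped_flow_stable//; exact: attracted_set_preflow.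
- move=> k kn; rewrite -subset0 => x [[Ax _] Ex].
  by have := stable_set_disjoint NE_pair (AS k.+1 kn _ Ax); apply.
- by move=> k kn; have [] := Hm k kn.
- move=> x attr0; apply: stopped_flow_reaches_exit => //.
  apply: (@uniformly_eventually0 _ _ Phi N E); apply: attr0; first exact: open0.
  by rewrite A0.
- move=> k x _ kn attrx [G oG <-] PG.
  (* A point of [A k.+1] lies in [D k] or in the basin of [A k], hence in [attr k]. *)
  have AG : A k.+1 `<=` G.
    move=> a Aa; have [Na _] := AS k.+1 kn a Aa.
    have := PG (exist _ a (mem_set Na)); apply.
    have [ba|nba] := pselect (attraction_basin Phi K (A k) a); last by right.
    by left; exact: basin_attr.
  have [[V B] /= [xV [t [_ tB]]] VB] := attrx G oG AG.
  exists (set_val @^-1` V, [set s | Num.max t 0 < s]) => /=.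
    split; first exact: set_val_near.
    by exists (Num.max t 0); split => //; exact: num_real.
  move=> [y s] /= [Vy]; rewrite gt_max => /andP[ts s0].
  (* Stable points enter [G] by attraction to [A k.+1]; unstable ones stay unstable, hence in
     [attr k]. *)
  have [Sy|nSy] := pselect (S (set_val y)).
    rewrite stopped_flow_stable ?(ltW s0)//.
    by apply: (VB (set_val y, s)) => //; split => //; exact: tB.
  apply: (PG (stopped_flow Phi E (s, y))); left; apply: unstable_attr.
  exact: stopped_flow_unstable.
- exact: closedT.
- exact: subsetT.
(* The top set of the filtration is all of [N], since [K] attracts every point. *)
- move=> x _ /=; rewrite /attr An; exact: attracted_set_max.
Qed.
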